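(* Let $k=3$ and let the initial store be $IS=(\Box,\blacksquare,\blacksquare)$. The compositional translation $\tau:\mathrm{SYNCSIMPLE}\to\mathrm{LOCKSIMPLE}_{3,IS}$ given by $\tau(!)=P_1T_3P_2T_1$ and $\tau(?)=P_3T_2$ is correct.
   Context: SYNCSIMPLE. Subprocesses are given by $\mathcal U ::= \checkmark \mid 0 \mid\ !\mathcal U \mid\ ?\mathcal U$, and processes are finite parallel compositions $\mathcal U_1 | \cdots | \mathcal U_n$ ($n\ge 1$), where $|$ is associative and commutative with identity element $0$ (so a process is a finite multiset of subprocesses). One step: $!\mathcal U_1 | ?\mathcal U_2 | \mathcal P \to \mathcal U_1 | \mathcal U_2 | \mathcal P$ for subprocesses $\mathcal U_1,\mathcal U_2$ and any process $\mathcal P$. A process is successful if it has the form $\checkmark | \mathcal P$. LOCKSIMPLE$_{k,IS}$ ($k\ge1$, $IS\in\{\Box,\blacksquare\}^k$; $\Box$ = empty, $\blacksquare$ = full). Subprocesses: $\mathcal U ::= \checkmark \mid 0 \mid P_i\,\mathcal U \mid T_i\,\mathcal U$ with $i\in\{1,\dots,k\}$; processes are finite parallel compositions (multisets) of subprocesses as before. States are pairs $(\mathcal P,(C_1,\dots,C_k))$ with $C_i\in\{\Box,\blacksquare\}$. Steps: $(P_i\mathcal U | \mathcal P,\mathcal C)\to(\mathcal U|\mathcal P,\mathcal C[C_i\mapsto\blacksquare])$ allowed only if $C_i=\Box$ in $\mathcal C$ (otherwise $P_i$ waits); $(T_i\mathcal U|\mathcal P,\mathcal C)\to(\mathcal U|\mathcal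 P,\mathcal C[C_i\mapsto\Box])$ always allowed. A state is successful if its process has the form $\checkmark|\mathcal P$. Convergence (for SYNCSIMPLE processes, and for LOCKSIMPLE states). With $\to^*$ the reflexive-transitive closure of the step relation: an element is may-convergent if it reduces by $\to^*$ to a successful one; must-convergent if everything reachable from it by $\to^*$ is may-convergent. A LOCKSIMPLE$_{k,IS}$ process $\mathcal P$ has one of these properties iff the state $(\mathcal P,IS)$ has it. Translations. A translation is a map $\tau$ from SYNCSIMPLE processes to LOCKSIMPLE$_{k,IS}$ processes. It is compositional if there are finite strings $\tau(!),\tau(?)$ over $\{P_1,T_1,\dots,P_k,T_k\}$ such that $\tau(0)=0$, $\tau(\checkmark)=\checkmark$, $\tau(!\mathcal U)=\tau(!)\tau(\mathcal U)$, $\tau(?\mathcal U)=\tau(?)\tau(\mathcal U)$, and $\tau(\mathcal P_1|\mathcal P_2)=\tau(\mathcal P_1)|\tau(\mathcal P_2)$. It is correct if for all SYNCSIMPLE processes $\mathcal P$: $\mathcal P$ is may-convergent iff $\tau(\mathcal P)$ is, and $\mathcal P$ is must-convergent iff $\tau(\mathcal P)$ is. *)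

(* Defs.v *)
From Stdlib Require Import Relations.
From mathcomp Require Import all_boot.

Set Implicit Arguments.
Unset Strict Implicit.
Unset Printing Implicit Defensive.

(* SYNCSIMPLE and LOCKSIMPLE share the grammar  U ::= tick | 0 | a U  of
   subprocesses and differ only in the type [A] of prefixes [a]. *)
Inductive subprocess (A : Type) : Type :=
| Tick
| Zero
| Prefix of A & subprocess A.

Arguments Tick {A}.
Arguments Zero {A}.

Inductive process (A : Type) : Type :=
| Proc of subprocess A
| Par of process A & process A.

Notation "p ||| q" := (Par p q) (at level 50, left associativity).
Notation "a ⋅ u" := (Prefix a u) (at level 35, right associativity).

(* Processes are finite multisets of subprocesses in which 0 does not count:
   [process A] is the raw syntax, and all notions below are closed under [≡]. *)
Reserved Notation "p ≡ q" (at level 70, no associativity).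
Inductive scong (A : Type) : process A -> process A -> Prop :=
| scong_refl p : p ≡ p
| scong_sym p q : p ≡ q -> q ≡ p
| scong_trans p q r : p ≡ q -> q ≡ r -> p ≡ r
| scong_par p p' q q' : p ≡ p' -> q ≡ q' -> p ||| q ≡ p' ||| q'
| scong_parA p q r : p ||| (q ||| r) ≡ (p ||| q) ||| r
| scong_parC p q : p ||| q ≡ q ||| p
| scong_par0 p : p ||| Proc Zero ≡ p
where "p ≡ q" := (scong p q).

Definition successful (A : Type) (p : process A) : Prop :=
  exists q, p ≡ Proc Tick ||| q.

Definition may_convergent (X : Type) (step : relation X) (succ : X -> Prop)
    (x : X) : Prop :=
  exists y, clos_refl_trans X step x y /\ succ y.

Definition must_convergent (X : Type) (step : relation X) (succ : X -> Prop)
    (x : X) : Prop :=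
  forall y, clos_refl_trans X step x y -> may_convergent step succ y.

Inductive sync_action : Type := Bang | Quest.

Definition sync_process : Type := process sync_action.

Inductive sync_step : relation sync_process :=
| SyncStep p p' u1 u2 q :
    p ≡ Proc (Bang ⋅ u1) ||| Proc (Quest ⋅ u2) ||| q ->
    p' ≡ Proc u1 ||| Proc u2 ||| q ->
    sync_step p p'.

Definition sync_may : sync_process -> Prop :=
  may_convergent sync_step (@successful sync_action).

Definition sync_must : sync_process -> Prop :=
  must_convergent sync_step (@successful sync_action).

Inductive cell : Type := Empty | Full.

Definition store (k : nat) : Type := k.-tuple cell.

Definition set_cell (k : nat) (C : store k) (i : 'I_k) (c : cell) : store k :=
  [tuple if j == i then c else tnth C j | j < k].

(* [Put i] is P_(i+1) and [Take i] is T_(i+1): ordinals start at 0. *)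
Inductive lock_action (k : nat) : Type :=
| Put of 'I_k
| Take of 'I_k.

Definition lock_process (k : nat) : Type := process (lock_action k).

Definition lock_state (k : nat) : Type := (lock_process k * store k)%type.

Inductive lock_step (k : nat) : relation (lock_state k) :=
| PutStep p p' u q i C :
    p ≡ Proc (Put i ⋅ u) ||| q ->
    p' ≡ Proc u ||| q ->
    tnth C i = Empty ->
    lock_step (p, C) (p', set_cell C i Full)
| TakeStep p p' u q i C :
    p ≡ Proc (Take i ⋅ u) ||| q ->
    p' ≡ Proc u ||| q ->
    lock_step (p, C) (p', set_cell C i Empty).

Definition lock_successful (k : nat) (s : lock_state k) : Prop :=
  successful s.1.

Definition lock_may (k : nat) (IS : store k) (p : lock_process k) : Prop :=
  may_convergent (@lock_step k) (@lock_successful k) (p, IS).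

Definition lock_must (k : nat) (IS : store k) (p : lock_process k) : Prop :=
  must_convergent (@lock_step k) (@lock_successful k) (p, IS).

Definition correct (k : nat) (IS : store k)
    (tau : sync_process -> lock_process k) : Prop :=
  forall p : sync_process,
    (sync_may p <-> lock_may IS (tau p)) /\
    (sync_must p <-> lock_must IS (tau p)).

(* The compositional translation is determined by the strings
   [w Bang] = tau(!) and [w Quest] = tau(?). *)
Fixpoint translate_sub (k : nat) (w : sync_action -> seq (lock_action k))
    (u : subprocess sync_action) : subprocess (lock_action k) :=
  match u with
  | Tick => Tick
  | Zero => Zero
  | a ⋅ v => foldr (@Prefix _) (translate_sub w v) (w a)
  end.

Fixpoint compositional_translation (k : nat)
    (w : sync_action -> seq (lock_action k))
    (p : sync_process) : lock_process k :=
  match p with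
  | Proc u => Proc (translate_sub w u)
  | p1 ||| p2 =>
      compositional_translation w p1 ||| compositional_translation w p2
  end.

(* Hence the translation is well defined on processes modulo [≡]. *)
Lemma compositional_translation_scong (k : nat)
    (w : sync_action -> seq (lock_action k)) (p q : sync_process) :
  p ≡ q -> compositional_translation w p ≡ compositional_translation w q.
Proof.
elim=> {p q} /= *; [exact: scong_refl|exact: scong_sym|by apply: scong_trans; eassumption
  |exact: scong_par|exact: scong_parA|exact: scong_parC|exact: scong_par0].
Qed.

Definition c1 : 'I_3 := @Ordinal 3 0 isT.
Definition c2 : 'I_3 := @Ordinal 3 1 isT.
Definition c3 : 'I_3 := @Ordinal 3 2 isT.

(* Main.v *)
(** The six actions of a handshake form a lock-protected protocol: writing the
    store as (C1, C2, C3), every run of a translated process cycles through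
      (E,F,F) -P1-> (F,F,F) -T3-> (F,F,E) -P3-> (F,F,F) -T2-> (F,E,F)
              -P2-> (F,F,F) -T1-> (E,F,F),
    where E and F stand for empty and full, P1 T3 P2 T1 are performed by one
    fixed sender and P3 T2 by one fixed receiver, every other component being
    blocked at a P1 or at a P3. The SYNCSIMPLE step is matched with the action
    P3, when the receiver is chosen. The sender is already fixed by P1, but this
    costs nothing: if the source process can take a step at all, then it has a
    receiver, and the fixed sender can communicate with it. *)
From Stdlib Require Import Relations Permutation Setoid Morphisms List.
Require Import Defs.
From mathcomp Require Import all_boot.

Set Implicit Arguments.
Unset Strict Implicit.
Unset Printing Implicit Defensive.

#[export] Hint Resolve scong_refl : core.

(** * Structural congruence as equality of multisets *)

Section StructuralCongruence.
Variable A : Type.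
Implicit Types (u v x y : subprocess A) (p q r : process A).

#[export] Instance scong_equivalence : Equivalence (@scong A).
Proof.
split; [exact: scong_refl | exact: scong_sym | exact: scong_trans].
Qed.

#[export] Instance Par_proper :
  Proper (@scong A ==> @scong A ==> @scong A) (@Par A).
Proof. by move=> p p' hp q q' hq; exact: scong_par. Qed.

Lemma scong_parCA p q r : p ||| (q ||| r) ≡ q ||| (p ||| r).
Proof. by rewrite !scong_parA (scong_parC p q). Qed.

Lemma scong_0par p : Proc Zero ||| p ≡ p.
Proof. by rewrite scong_parC scong_par0. Qed.

(** Zeros are dropped, so that [≡] becomes permutation of these lists. *)
Fixpoint components p : list (subprocess A) :=
  match p with
  | Proc Zero => nil
  | Proc u => u :: nil
  | p1 ||| p2 => app (components p1) (components p2)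
  end.

Fixpoint parallel (l : list (subprocess A)) : process A :=
  if l is u :: l' then Proc u ||| parallel l' else Proc Zero.

Lemma parallel_app l l' : parallel (app l l') ≡ parallel l ||| parallel l'.
Proof.
elim: l => [|u l IH] /=; first by rewrite scong_0par.
by rewrite IH scong_parA.
Qed.

Lemma parallel_components p : parallel (components p) ≡ p.
Proof.
elim: p => [[| |a u]|p IHp q IHq] //=; try exact: scong_par0.
by rewrite parallel_app IHp IHq.
Qed.

Lemma parallel_Permutation l l' : Permutation l l' -> parallel l ≡ parallel l'.
Proof.
elim=> //= [u l1 l2 _ -> //|u v l1|l1 l2 l3 _ -> _ -> //].
exact: scong_parCA.
Qed.

(** Each rule of [≡] permutes the component list; conversely [parallel] rebuilds a process from its
    list up to [≡]. Cancellation is thereby inherited from permutations. *)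
Lemma scongP p q : p ≡ q <-> Permutation (components p) (components q).
Proof.
split; last first.
  by move/parallel_Permutation; rewrite !parallel_components.
elim=> {p q} /= [p|p q _ /Permutation_sym|p q r _ h1 _ h2|p p' q q' _ h1 _ h2
  |p q r|p q|p] //.
- exact: Permutation_trans h1 h2.
- exact: Permutation_app.
- by rewrite app_assoc.
- exact: Permutation_app_comm.
- by rewrite app_nil_r.
Qed.

Lemma scong_par_cancel p q r : p ||| q ≡ p ||| r -> q ≡ r.
Proof. by move/scongP/Permutation_app_inv_l/scongP. Qed.

Lemma in_components p x :
  In x (components p) -> exists q, p ≡ Proc x ||| q.
Proof.
move/(@in_split _ _ _) => [l1 [l2 e]]; exists (parallel (app l1 l2)).
rewrite -(parallel_components p) e -/(parallel (x :: app l1 l2)).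
exact/parallel_Permutation/Permutation_sym/Permutation_middle.
Qed.

Lemma components_scong p q x :
  p ≡ Proc x ||| q -> x <> Zero -> In x (components p).
Proof.
move=> /scongP/Permutation_sym h nz; apply: (Permutation_in _ h).
by case: x nz {h} => //= *; left.
Qed.

(** Serves to decide which component acts: a nonzero [y] survives in [components], either as [x]
    itself or inside [p]. *)
Lemma scong_par_inv x p y q :
  Proc x ||| p ≡ Proc y ||| q -> y <> Zero ->
  (x = y /\ p ≡ q) \/
  (exists r, p ≡ Proc y ||| r /\ q ≡ Proc x ||| r).
Proof.
move=> e nz; have [xy|yp] : x = y \/ In y (components p).
- by move: (components_scong e nz) => /=; case: (x) => [| |a u] /=; tauto.
- by left; split=> //; move: e; rewrite xy; exact: scong_par_cancel.
- right; have [r pr] := in_components yp; exists r; split=> //.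
  by move: e; rewrite pr scong_parCA => /scong_par_cancel ->.
Qed.

#[export] Instance successful_proper :
  Proper (@scong A ==> iff) (@successful A).
Proof.
by move=> p p' e; split=> -[q h]; exists q; move: h; rewrite e.
Qed.

Lemma successful_par p q : successful q -> successful (p ||| q).
Proof. by move=> [r ->]; exists (p ||| r); rewrite scong_parCA. Qed.

(** A prefixed component is not [Tick], so the tick lies in [p]. *)
Lemma successful_prefix a u p : successful (Proc (a ⋅ u) ||| p) -> successful p.
Proof.
by move=> [q /scong_par_inv [//|[] //|[r [pr _]]]]; exists r.
Qed.

End StructuralCongruence.

(** * Convergence along runs *)

Lemma must_convergent_reach (X : Type) (step : relation X) (succ : X -> Prop) x y :
  must_convergent step succ x -> clos_refl_trans X step x y ->
  must_convergent step succ y.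
Proof. by move=> mx xy z yz; apply: mx; exact: rt_trans xy yz. Qed.

Lemma must_convergent_may (X : Type) (step : relation X) (succ : X -> Prop) x :
  must_convergent step succ x -> may_convergent step succ x.
Proof. by apply; exact: rt_refl. Qed.

Lemma may_convergent_reach (X : Type) (step : relation X) (succ : X -> Prop) x y :
  clos_refl_trans X step x y -> may_convergent step succ y ->
  may_convergent step succ x.
Proof.
by move=> xy [z [yz sz]]; exists z; split=> //; exact: rt_trans xy yz.
Qed.

(** * Lock steps and store updates *)

Section LockStep.
Variable k : nat.
Implicit Types (C : store k) (a : lock_action k).

(** A relation, since [Put] can be blocked; it lets one statement cover both step rules. *)
Definition fires C a C' : Prop :=
  match a with
  | Put i => tnth C i = Empty /\ C' = set_cell C i Full
  | Take i => C' = set_cell C i Empty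
  end.

Lemma lock_stepP p C p' C' :
  lock_step (p, C) (p', C') <->
  exists a u q, [/\ p ≡ Proc (a ⋅ u) ||| q, p' ≡ Proc u ||| q & fires C a C'].
Proof.
split=> [h|[[i|i] [u [q [hp hp' /= h]]]]].
- by inversion h; subst; [exists (Put i), u, q|exists (Take i), u, q].
- by case: h => hi ->; apply: PutStep hp hp' hi.
- by rewrite h; apply: TakeStep hp hp'.
Qed.

End LockStep.

Lemma set_cell_c1 (a b c d : cell) :
  set_cell [tuple a; b; c] c1 d = [tuple d; b; c].
Proof. by apply: eq_from_tnth => -[[|[|[|//]]] h]; rewrite tnth_mktuple. Qed.

Lemma set_cell_c2 (a b c d : cell) :
  set_cell [tuple a; b; c] c2 d = [tuple a; d; c].
Proof. by apply: eq_from_tnth => -[[|[|[|//]]] h]; rewrite tnth_mktuple. Qed.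

Lemma set_cell_c3 (a b c d : cell) :
  set_cell [tuple a; b; c] c3 d = [tuple a; b; d].
Proof. by apply: eq_from_tnth => -[[|[|[|//]]] h]; rewrite tnth_mktuple. Qed.

(** * Translated processes and the phases of the handshake *)

Definition handshake (a : sync_action) : seq (lock_action 3) :=
  match a with
  | Bang => [:: Put c1; Take c3; Put c2; Take c1]
  | Quest => [:: Put c3; Take c2]
  end.

Local Notation tau := (compositional_translation handshake).
Local Notation tau_sub := (translate_sub handshake).
Local Notation store3 a b c := ([tuple a; b; c] : store 3).
Local Notation IS := (store3 Empty Full Full).
Local Notation lock_run := (clos_refl_trans (lock_state 3) (@lock_step 3)).
Local Notation sync_run := (clos_refl_trans sync_process sync_step).

Lemma tau_inv P x q :
  tau P ≡ Proc x ||| q -> x <> Zero ->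
  exists v Q, [/\ P ≡ Proc v ||| Q, tau_sub v = x & q ≡ tau Q].
Proof.
move=> e nz; have : In x (components (tau P)) by exact: components_scong e nz.
have: In x (components (tau P)) ->
    exists v, In v (components P) /\ tau_sub v = x.
  elim: P {e} => [[| |[] u]|P IHP Q IHQ] //=; try by case=> // <-; eexists; split; [left|].
  by rewrite in_app_iff => -[/IHP|/IHQ] [v [hv <-]]; exists v; rewrite in_app_iff; tauto.
move=> h /h [v [/in_components [Q PQ] vx]]; exists v, Q; split=> //.
move: e; rewrite (compositional_translation_scong handshake PQ) /= vx.
by move/scong_par_cancel ->.
Qed.

(** The two strings begin with P1 and P3, so no translated component can start with anything
    else. *)
Lemma tau_action_inv P a u q :
  tau P ≡ Proc (a ⋅ u) ||| q ->
  (exists v Q, [/\ a = Put c1, P ≡ Proc (Bang ⋅ v) ||| Q,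
     u = Take c3 ⋅ Put c2 ⋅ Take c1 ⋅ tau_sub v & q ≡ tau Q]) \/
  (exists v Q, [/\ a = Put c3, P ≡ Proc (Quest ⋅ v) ||| Q,
     u = Take c2 ⋅ tau_sub v & q ≡ tau Q]).
Proof.
move=> /tau_inv [] // v [Q []]; case: v => [| |[] v] // PQ [<- <-] qQ.
- by left; exists v, Q.
- by right; exists v, Q.
Qed.

Lemma successful_tau P : successful (tau P) <-> successful P.
Proof.
split=> [[q /tau_inv [] // [| |[] v] [Q [] // PQ _ _]]|[q Pq]]; first by exists Q.
by exists (tau q); exact: (compositional_translation_scong handshake Pq).
Qed.

(* From [receiver_ready] on, the source process is the one obtained by the
   communication in progress. *)
Inductive phase : lock_state 3 -> sync_process -> Prop :=
| idle p P : p ≡ tau P -> phase (p, IS) P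
| sender_locked p u Q P :
    p ≡ Proc (Take c3 ⋅ Put c2 ⋅ Take c1 ⋅ tau_sub u) ||| tau Q ->
    P ≡ Proc (Bang ⋅ u) ||| Q ->
    phase (p, store3 Full Full Full) P
| sender_waiting p u Q P :
    p ≡ Proc (Put c2 ⋅ Take c1 ⋅ tau_sub u) ||| tau Q ->
    P ≡ Proc (Bang ⋅ u) ||| Q ->
    phase (p, store3 Full Full Empty) P
| receiver_ready p u v Q P :
    p ≡ Proc (Put c2 ⋅ Take c1 ⋅ tau_sub u) |||
          (Proc (Take c2 ⋅ tau_sub v) ||| tau Q) ->
    P ≡ Proc u ||| (Proc v ||| Q) ->
    phase (p, store3 Full Full Full) P
| receiver_done p u Q P :
    p ≡ Proc (Put c2 ⋅ Take c1 ⋅ tau_sub u) ||| tau Q ->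
    P ≡ Proc u ||| Q ->
    phase (p, store3 Full Empty Full) P
| sender_releasing p u Q P :
    p ≡ Proc (Take c1 ⋅ tau_sub u) ||| tau Q ->
    P ≡ Proc u ||| Q ->
    phase (p, store3 Full Full Full) P.

(** P1 and P3 are the only initial actions, and both wait while C1 and C3 are full, whatever C2
    holds. *)
Lemma tau_blocked P a u q C b :
  tau P ≡ Proc (a ⋅ u) ||| q -> ~ fires (store3 Full b Full) a C.
Proof. by move/tau_action_inv => [] [v [Q [-> _ _ _]]] []. Qed.

(** In each phase the store and the pending prefixes allow one kind of action. Only P3 is matched by
    a source step; the others keep [P]. *)
Lemma phase_step s s' P :
  phase s P -> lock_step s s' ->
  phase s' P \/ exists P', sync_step P P' /\ phase s' P'.
Proof.
case: s' => p' C' []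
  => [p {}P pP|p u Q {}P pQ PQ|p u Q {}P pQ PQ|p u v Q {}P pQ PQ|p u Q {}P pQ PQ
     |p u Q {}P pQ PQ] /lock_stepP [a [x [q [px p'x]]]].
(* C3 is full, so P3 waits and only P1 can fire. *)
- move: px; rewrite pP => /tau_action_inv [] [v [Q [-> PQ xv qQ]]] [] // _ ->.
  by rewrite set_cell_c1; left; apply: sender_locked PQ; rewrite p'x xv qQ.
- move: px; rewrite pQ => /scong_par_inv [//|[[<- xu] Qq]|[r [/tau_blocked h _ /h //]]].
  move=> /= ->; rewrite set_cell_c3; left; apply: sender_waiting PQ.
  by rewrite p'x -xu Qq.
(* The sender waits at P2 and other senders at P1, so a receiver in [Q] performs P3; this fixes [v]
   and the source communication. *)
- move: px; rewrite pQ => /scong_par_inv [//|[[<- xu] Qq] [] //|[r [+ qr]]].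
  move=> /tau_action_inv [] [v [Q' [-> QQ' xv rQ']]] [] // _ ->.
  rewrite set_cell_c3; right; exists (Proc u ||| (Proc v ||| Q')); split.
    apply: (@SyncStep _ _ u v Q'); last by rewrite scong_parA.
    by rewrite PQ QQ' scong_parA.
  apply: (@receiver_ready _ u v Q') => //.
  by rewrite p'x qr xv rQ' scong_parCA.
(* P2 still waits since C2 is full, so the chosen receiver performs T2; its continuation then joins
   the idle components. *)
- move: px; rewrite pQ => /scong_par_inv [//|[[<- xu] Qq] [] //|[r [+ qr]]].
  move=> /scong_par_inv [//|[[<- xv] Qr]|[r' [/tau_blocked h _ /h //]]] /= ->.
  rewrite set_cell_c2; left; apply: (@receiver_done _ u (Proc v ||| Q)) => //.
  by rewrite p'x qr -xv -Qr /= scong_parCA.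
- move: px; rewrite pQ => /scong_par_inv [//|[[<- xu] Qq]|[r [/tau_blocked h _ /h //]]].
  move=> [_ ->]; rewrite set_cell_c2; left; apply: sender_releasing PQ.
  by rewrite p'x -xu Qq.
- move: px; rewrite pQ => /scong_par_inv [//|[[<- xu] Qq]|[r [/tau_blocked h _ /h //]]].
  move=> /= ->; rewrite set_cell_c1; left; apply: idle.
  by rewrite (compositional_translation_scong handshake PQ) /= p'x -xu Qq.
Qed.

Lemma phase_run s s' P :
  phase s P -> lock_run s s' -> exists P', sync_run P P' /\ phase s' P'.
Proof.
move=> sP /(@clos_rt_rt1n _ _ _ _) run; elim: run P sP => {s s'} [s|s s1 s2 step _ IH] P sP.
  by exists P; split=> //; exact: rt_refl.
have [/IH //|[P1 [PP1 /IH [P2 [P12 h]]]]] := phase_step sP step.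
by exists P2; split=> //; exact: rt_trans (rt_step _ _ _ _ PP1) P12.
Qed.

(** Components inside the protocol are prefixed, so a tick comes from [tau Q], and [Q] is part of
    [P]. *)
Lemma phase_successful s P : phase s P -> lock_successful s -> successful P.
Proof.
rewrite /lock_successful.
case=> [p {}P /= ->|p u Q {}P /= -> ->|p u Q {}P /= -> ->|p u v Q {}P /= -> ->
  |p u Q {}P /= -> ->|p u Q {}P /= -> ->]; first by rewrite successful_tau.
(* The second attempt strips the receiver, which is pending only in [receiver_ready]. *)
all: move/(@successful_prefix _ _ _ _); try move/(@successful_prefix _ _ _ _); rewrite successful_tau => h.
all: by do ?apply: successful_par.
Qed.

(** * Completing a handshake and simulating source steps *)

(** From here to [sender_waiting_run] the cycle is traversed backwards: each lemma prepends one
    action to the preceding run into [IS]. *)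
Lemma sender_releasing_run p u Q :
  p ≡ Proc (Take c1 ⋅ tau_sub u) ||| tau Q ->
  lock_step (p, store3 Full Full Full) (tau (Proc u ||| Q), IS).
Proof.
move=> pQ; apply/lock_stepP; exists (Take c1), (tau_sub u), (tau Q).
by rewrite /fires set_cell_c1.
Qed.

Lemma receiver_done_run p u Q :
  p ≡ Proc (Put c2 ⋅ Take c1 ⋅ tau_sub u) ||| tau Q ->
  lock_run (p, store3 Full Empty Full) (tau (Proc u ||| Q), IS).
Proof.
move=> pQ; apply: rt_trans (rt_step _ _ _ _ (sender_releasing_run (scong_refl _))).
apply/rt_step/lock_stepP; exists (Put c2), (Take c1 ⋅ tau_sub u), (tau Q).
by rewrite /fires set_cell_c2.
Qed.

Lemma receiver_ready_run p u v Q :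
  p ≡ Proc (Put c2 ⋅ Take c1 ⋅ tau_sub u) |||
        (Proc (Take c2 ⋅ tau_sub v) ||| tau Q) ->
  lock_run (p, store3 Full Full Full) (tau (Proc u ||| (Proc v ||| Q)), IS).
Proof.
move=> pQ; apply: rt_trans (receiver_done_run (scong_refl _)).
apply/rt_step/lock_stepP; exists (Take c2), (tau_sub v).
exists (Proc (Put c2 ⋅ Take c1 ⋅ tau_sub u) ||| tau Q).
by rewrite /fires set_cell_c2; split=> //=; rewrite ?pQ scong_parCA.
Qed.

Lemma sender_waiting_run p u v Q :
  p ≡ Proc (Put c2 ⋅ Take c1 ⋅ tau_sub u) ||| tau (Proc (Quest ⋅ v) ||| Q) ->
  lock_run (p, store3 Full Full Empty) (tau (Proc u ||| (Proc v ||| Q)), IS).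
Proof.
move=> pQ; apply: rt_trans (receiver_ready_run (scong_refl _)).
apply/rt_step/lock_stepP; exists (Put c3), (Take c2 ⋅ tau_sub v).
exists (Proc (Put c2 ⋅ Take c1 ⋅ tau_sub u) ||| tau Q).
by rewrite /fires set_cell_c3; split=> //=; rewrite ?pQ scong_parCA.
Qed.

(** No receiver is assumed here, so only T3 is performed. *)
Lemma sender_locked_run p u Q :
  p ≡ Proc (Take c3 ⋅ Put c2 ⋅ Take c1 ⋅ tau_sub u) ||| tau Q ->
  lock_step (p, store3 Full Full Full)
    (Proc (Put c2 ⋅ Take c1 ⋅ tau_sub u) ||| tau Q, store3 Full Full Empty).
Proof.
move=> pQ; apply/lock_stepP.
exists (Take c3), (Put c2 ⋅ Take c1 ⋅ tau_sub u), (tau Q).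
by rewrite /fires set_cell_c3.
Qed.

(** All six actions are performed in order. A source step fixes its target only up to [≡], hence the
    representative [P'']. *)
Lemma sync_step_run p P P' :
  p ≡ tau P -> sync_step P P' ->
  exists2 P'', P' ≡ P'' & lock_run (p, IS) (tau P'', IS).
Proof.
move=> + step; case: step => {}P {}P' u v Q PQ P'Q pP.
exists (Proc u ||| (Proc v ||| Q)); first by rewrite P'Q scong_parA.
apply: rt_trans (sender_waiting_run (scong_refl _)).
apply: rt_trans (rt_step _ _ _ _ (sender_locked_run (scong_refl _))).
apply/rt_step/lock_stepP; exists (Put c1), (Take c3 ⋅ Put c2 ⋅ Take c1 ⋅ tau_sub u).
exists (tau (Proc (Quest ⋅ v) ||| Q)); rewrite /fires set_cell_c1; split=> //.
rewrite pP (compositional_translation_scong handshake PQ) /=.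
by rewrite scong_parA.
Qed.

(** * Transfer of convergence *)

Lemma sync_may_lock_may p P : p ≡ tau P -> sync_may P -> lock_may IS p.
Proof.
move=> pP [P' [/(@clos_rt_rt1n _ _ _ _) run succ]].
elim: run p succ pP => {P P'} [P|P P1 P2 step _ IH] p succ pP.
  exists (p, IS); split; first exact: rt_refl.
  by rewrite /lock_successful /= pP successful_tau.
have [P1' e run] := sync_step_run pP step.
apply: may_convergent_reach run _; apply: IH succ _.
exact/scong_sym/(compositional_translation_scong handshake e).
Qed.

Lemma phase_may s P :
  phase s P -> may_convergent (@lock_step 3) (@lock_successful 3) s -> sync_may P.
Proof.
move=> sP [s' [run succ]]; have [P' [PP' s'P']] := phase_run sP run.
by exists P'; split=> //; exact: phase_successful s'P' succ.
Qed.

(** The critical case: the sender [u] is fixed, while a successful source run may begin with another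
    sender. That run still yields a receiver [v], and must-convergence covers the communication of
    [u] with [v]. *)
Lemma sender_waiting_may p u Q P :
  p ≡ Proc (Put c2 ⋅ Take c1 ⋅ tau_sub u) ||| tau Q ->
  P ≡ Proc (Bang ⋅ u) ||| Q ->
  sync_must P ->
  may_convergent (@lock_step 3) (@lock_successful 3) (p, store3 Full Full Empty).
Proof.
move=> pQ PQ must; have [P' [/(@clos_rt_rt1n _ _ _ _) run succ]] := must_convergent_may must.
case: run succ => {P'} [|P1 P' step _] succ.
  (* With no source step, [P] already has a tick, necessarily in [Q]. *)
  exists (p, store3 Full Full Empty); split; first exact: rt_refl.
  rewrite /lock_successful /= pQ; apply/successful_par/successful_tau.
  by move: succ; rewrite PQ => /(@successful_prefix _ _ _ _).
case: step must PQ => {}P {}P1 u' v Q' PQ' _ must PQ.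
(* The receiver of the first step differs from the fixed sender by its prefix, so it lies in [Q]. *)
have [Q1 QQ1] : exists Q1, Q ≡ Proc (Quest ⋅ v) ||| Q1.
  move: PQ'; rewrite PQ -scong_parA scong_parCA => /scong_par_inv [//|[]|] //.
  by move=> [r [Qr _]]; exists r.
have run : lock_run (p, store3 Full Full Empty) (tau (Proc u ||| (Proc v ||| Q1)), IS).
  apply: sender_waiting_run; rewrite pQ.
  by rewrite (compositional_translation_scong handshake QQ1).
apply: may_convergent_reach run _; apply: sync_may_lock_may (scong_refl _) _.
apply: must; apply/rt_step/(@SyncStep _ _ u v Q1).
- by rewrite PQ QQ1 scong_parA.
- by rewrite scong_parA.
Qed.

(** Once P3 has been performed, completing the handshake reaches a translation of [P] up to [≡], and
    may-convergence suffices; the two earlier non-idle phases rely on [sender_waiting_may]. *)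
Lemma phase_must s P :
  phase s P -> sync_must P -> may_convergent (@lock_step 3) (@lock_successful 3) s.
Proof.
move=> sP must; have may := must_convergent_may must.
case: sP must may => [p {}P pP|p u Q {}P pQ PQ|p u Q {}P pQ PQ|p u v Q {}P pQ PQ|p u Q {}P pQ PQ
     |p u Q {}P pQ PQ] must may.
- exact: sync_may_lock_may pP may.
- apply: may_convergent_reach (rt_step _ _ _ _ (sender_locked_run pQ)) _.
  exact: sender_waiting_may (scong_refl _) PQ must.
- exact: sender_waiting_may pQ PQ must.
- apply: may_convergent_reach (receiver_ready_run pQ) _.
  apply: sync_may_lock_may may.
  exact/scong_sym/(compositional_translation_scong handshake PQ).
- apply: may_convergent_reach (receiver_done_run pQ) _.
  apply: sync_may_lock_may may.
  exact/scong_sym/(compositional_translation_scong handshake PQ).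
- apply: may_convergent_reach (rt_step _ _ _ _ (sender_releasing_run pQ)) _.
  apply: sync_may_lock_may may.
  exact/scong_sym/(compositional_translation_scong handshake PQ).
Qed.

(** Used to reflect must-convergence: every source reduct is represented by a reachable idle
    state. *)
Lemma sync_run_lock_run p P P' :
  p ≡ tau P -> sync_run P P' ->
  exists p', p' ≡ tau P' /\ lock_run (p, IS) (p', IS).
Proof.
move=> pP /(@clos_rt_rt1n _ _ _ _) run; elim: run p pP => {P P'} [P|P P1 P2 step _ IH] p pP.
  by exists p; split=> //; exact: rt_refl.
have [P1' e run1] := sync_step_run pP step.
have [|p2 [p2P run2]] := IH (tau P1').
  exact/scong_sym/(compositional_translation_scong handshake e).
by exists p2; split=> //; exact: rt_trans run1 run2.
Qed.

Theorem theorem2p9 :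
  correct [tuple Empty; Full; Full]
    (compositional_translation (fun a : sync_action =>
       match a with
       | Bang => [:: Put c1; Take c3; Put c2; Take c1]
       | Quest => [:: Put c3; Take c2]
       end)).
Proof.
move=> P; rewrite -/handshake.
have P0 : phase (tau P, IS) P by apply: idle; exact: scong_refl.
split; split.
- exact: sync_may_lock_may (scong_refl _).
- exact: phase_may P0.
(* A reachable lock state is in a phase of some source reduct, which is again must-convergent. *)
- move=> must s run; have [P' [PP' sP']] := phase_run P0 run.
  by apply: phase_must sP' _; exact: must_convergent_reach must PP'.
- move=> must P' PP'.
  have [p' [p'P' run]] := sync_run_lock_run (scong_refl (tau P)) PP'.
  exact: phase_may (idle p'P') (must _ run).
Qed.
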